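(* Let $I$ and $J$ be sets, let $V = (V(i))_{i \in I}$ and $W = (W(j))_{j \in J}$ be families of non-Archimedean Banach Abelian groups, and let $f \colon \prod V \to \bigoplus W$ be a non-zero bounded group homomorphism from the bounded direct product of $V$ to the completed direct sum of $W$. Then for any real number $r > 0$ there exist a real number $r' > \|f\|^{-1} r$, a finite subset $U_0 \subset \beta_{\omega} I$, and a finite subset $J_0 \subset J$ such that $$f\left[ \prod^{U_0,r'} V \right] \subset \bigoplus^{J_0,r} W.$$
   Context: A (non-Archimedean) normed Abelian group is an Abelian group $A$ with a map $\|\cdot\| \colon A \to \mathbb{R}_{\geq 0}$ such that $\|a - b\| \leq \max\{\|a\|,\|b\|\}$ for all $a,b \in A$, and $\|a\| = 0$ if and only if $a = 0$. It is a Banach Abelian group if the ultrametric $(a,b) \mapsto \|a-b\|$ is complete. A group homomorphism $f \colon A \to B$ between Banach Abelian groups is bounded if there is $C \in \mathbb{R}_{\geq 0}$ with $\|f(a)\| \leq C\|a\|$ for all $a \in A$; the operator norm $\|f\|$ is the infimum of such $C$. For a set $I$ and a family $V = (V(i))_{i \in I}$ of Banach Abelian groups, the bounded direct product $\prod V$ is the Banach Abelian group of all families $x = (x(i))_{i \in I}$ with $x(i) \in V(i)$ and $\sup_{i \in I}\|x(i)\| < \infty$, with norm $\|x\| = \sup_{i \in I}\|x(i)\|$ (the supremum over the empty set being $0$). The completed direct sum $\bigoplus V$ is the closed subgroup of those $x \in \prod V$ such that for every real $\epsilon > 0$ the set $\{i \in I : \|x(i)\| > \epsilon\}$ is finite.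 $\beta_{\omega} I$ denotes the set of ultrafilters of $I$ closed under countable intersection (principal ultrafilters included). For $U_0 \subset \beta_{\omega} I$ and $r \in \mathbb{R}_{\geq 0}$ put $$\prod^{U_0,r} V := \{x \in \prod V : \{i \in I : x(i) = 0\} \in \mathcal{F} \text{ for all } \mathcal{F} \in U_0, \text{ and } \|x(i)\| \leq r \text{ for all } i \in I\}.$$ For $J_0 \subset J$ and $r \in \mathbb{R}_{\geq 0}$ put $$\bigoplus^{J_0,r} W := \{y \in \bigoplus W : \|y(j)\| \leq r \text{ for all } j \in J \setminus J_0\}.$$ $f[X]$ denotes the image of the subset $X$ under $f$. *)

(* Defs.v *)
From HB Require Import structures.
From mathcomp Require Import all_boot all_order all_algebra.
From mathcomp Require Import all_classical all_reals.

Set Implicit Arguments.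
Unset Strict Implicit.
Unset Printing Implicit Defensive.

Import Order.TTheory GRing.Theory Num.Theory.

Local Open Scope classical_set_scope.
Local Open Scope ring_scope.

(* The norm of MathComp's normedZmodType is homogeneous for multiplication by
   natural numbers (`|x *+ n| = `|x| *+ n), so non-Archimedean norms need a
   structure of their own. *)
HB.mixin Record Zmodule_isUltraNormed (R : realType) A of GRing.Zmodule A := {
  unorm : A -> R;
  unorm_ge0 : forall a, 0 <= unorm a;
  unormB : forall a b, unorm (a - b) <= Num.max (unorm a) (unorm b);
  unorm_eq0 : forall a, unorm a = 0 <-> a = 0
}.

#[short(type="ultraNormedZmodType")]
HB.structure Definition UltraNormedZmodule (R : realType) :=
  {A of GRing.Zmodule A & Zmodule_isUltraNormed R A}.

Definition ucauchy (R : realType) (A : ultraNormedZmodType R) (u : nat -> A) :=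
  forall e : R, 0 < e -> exists N : nat,
    forall m n : nat, (N <= m)%N -> (N <= n)%N -> unorm (u m - u n) < e.

Definition uconverges (R : realType) (A : ultraNormedZmodType R)
    (u : nat -> A) (l : A) :=
  forall e : R, 0 < e -> exists N : nat,
    forall n : nat, (N <= n)%N -> unorm (u n - l) < e.

HB.mixin Record UltraNormedZmodule_isBanach (R : realType) A
    of UltraNormedZmodule R A := {
  ucomplete : forall u : nat -> A, ucauchy u -> exists l, uconverges u l
}.

#[short(type="ultraBanachType")]
HB.structure Definition UltraBanach (R : realType) :=
  {A of UltraNormedZmodule R A & UltraNormedZmodule_isBanach R A}.

Section UltraNormTheory.
Context (R : realType) (A : ultraNormedZmodType R).
Implicit Types a b : A.

Lemma unorm0 : unorm (0 : A) = 0.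
Proof. exact/unorm_eq0. Qed.

Lemma unormN a : unorm (- a) = unorm a.
Proof.
have le b : unorm (- b) <= unorm b.
  by rewrite -sub0r (le_trans (unormB _ _))// unorm0 ge_max unorm_ge0 lexx.
by apply/eqP; rewrite eq_le le/= -{1}(opprK a) le.
Qed.

Lemma unormD a b : unorm (a + b) <= Num.max (unorm a) (unorm b).
Proof. by rewrite -{1}(opprK b) -(unormN b) unormB. Qed.

End UltraNormTheory.

Section Operator.
Context (R : realType) (A B : ultraBanachType R).

Definition operator_bounds (f : A -> B) : set R :=
  [set C | 0 <= C /\ forall a, unorm (f a) <= C * unorm a].

Definition bounded_hom (f : A -> B) := operator_bounds f !=set0.

Definition opnorm (f : A -> B) : R := inf (operator_bounds f).

End Operator.

Section BoundedProduct.
Context (R : realType) (I : Type) (V : I -> ultraBanachType R).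

Record bprod := BProd {
  bprod_fun :> forall i, V i;
  bprod_bounded : has_ubound (range (fun i => unorm (bprod_fun i)))
}.

Lemma bprod_eq (x y : bprod) : (forall i, x i = y i) -> x = y.
Proof.
case: x y => [x xb] [y yb] /= xy.
have {}xy : x = y by exact: functional_extensionality_dep.
by subst y; congr BProd; exact: Prop_irrelevance.
Qed.

HB.instance Definition _ := gen_eqMixin bprod.
HB.instance Definition _ := gen_choiceMixin bprod.

Fact bprod_zero_bounded : has_ubound (range (fun i => unorm (0 : V i))).
Proof. by exists 0 => _ [i _ <-]; rewrite unorm0. Qed.

Fact bprod_opp_bounded (x : bprod) : has_ubound (range (fun i => unorm (- x i))).
Proof.
have [M xM] := bprod_bounded x.
by exists M => _ [i _ <-]; rewrite unormN; apply: xM; exists i.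
Qed.

Fact bprod_add_bounded (x y : bprod) :
  has_ubound (range (fun i => unorm (x i + y i))).
Proof.
have [M xM] := bprod_bounded x; have [N yN] := bprod_bounded y.
exists (Num.max M N) => _ [i _ <-]; rewrite (le_trans (unormD _ _))// ge_max !le_max.
have -> : unorm (x i) <= M by apply: xM; exists i.
have -> : unorm (y i) <= N by apply: yN; exists i.
by rewrite orbT.
Qed.

Definition bprod_zero := BProd bprod_zero_bounded.
Definition bprod_opp x := BProd (bprod_opp_bounded x).
Definition bprod_add x y := BProd (bprod_add_bounded x y).

Fact bprod_addA : associative bprod_add.
Proof. by move=> x y z; apply: bprod_eq => i /=; rewrite addrA. Qed.

Fact bprod_addC : commutative bprod_add.
Proof. by move=> x y; apply: bprod_eq => i /=; rewrite addrC. Qed.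

Fact bprod_add0 : left_id bprod_zero bprod_add.
Proof. by move=> x; apply: bprod_eq => i /=; rewrite add0r. Qed.

Fact bprod_addN : left_inverse bprod_zero bprod_opp bprod_add.
Proof. by move=> x; apply: bprod_eq => i /=; rewrite addNr. Qed.

HB.instance Definition _ := GRing.isZmodule.Build bprod
  bprod_addA bprod_addC bprod_add0 bprod_addN.

(* For I empty this is 0, since sup set0 = 0. *)
Definition bprod_norm (x : bprod) : R := sup (range (fun i => unorm (x i))).

Lemma bprod_norm_ub (x : bprod) i : unorm (x i) <= bprod_norm x.
Proof. by apply: ub_le_sup; [exact: bprod_bounded|exists i]. Qed.

Lemma bprod_norm_le (x : bprod) (M : R) :
  0 <= M -> (forall i, unorm (x i) <= M) -> bprod_norm x <= M.
Proof.
move=> M0 xM; rewrite /bprod_norm.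
set S := (X in sup X).
have [->|/set0P S0] := eqVneq S set0; first by rewrite sup0.
by apply: ge_sup => // _ [i _ <-].
Qed.

Fact bprod_norm_ge0 x : 0 <= bprod_norm x.
Proof.
rewrite /bprod_norm.
set S := (X in sup X); have [->|/set0P[_ [i _ _]]] := eqVneq S set0.
  by rewrite sup0.
exact: le_trans (unorm_ge0 _) (bprod_norm_ub x i).
Qed.

Fact bprod_normB x y :
  bprod_norm (x - y) <= Num.max (bprod_norm x) (bprod_norm y).
Proof.
apply: bprod_norm_le => [|i]; first by rewrite le_max bprod_norm_ge0.
rewrite (le_trans (unormB (x i) (y i)))//.
by rewrite ge_max !le_max !bprod_norm_ub orbT.
Qed.

Fact bprod_norm_eq0 x : bprod_norm x = 0 <-> x = 0.
Proof.
split=> [x0|->].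
  apply: bprod_eq => i; apply/unorm_eq0/eqP.
  by rewrite eq_le unorm_ge0 -x0 bprod_norm_ub.
apply/eqP; rewrite eq_le bprod_norm_ge0 andbT.
by apply: bprod_norm_le => // i; rewrite unorm0.
Qed.

HB.instance Definition _ :=
  Zmodule_isUltraNormed.Build R bprod
  bprod_norm_ge0 bprod_normB bprod_norm_eq0.

Fact bprod_complete (u : nat -> bprod) : ucauchy u -> exists l, uconverges u l.
Proof.
move=> uC.
have ui i : exists l : V i, uconverges (fun n => u n i) l.
  apply: ucomplete => e /uC[N uN]; exists N => m n Nm Nn.
  by apply: le_lt_trans (uN m n Nm Nn); exact: (bprod_norm_ub (u m - u n) i).
pose l i := projT1 (cid (ui i)).
have ul i : uconverges (fun n => u n i) (l i) := projT2 (cid (ui i)).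
have unif (e : R) : 0 < e ->
    exists N, forall n i, (N <= n)%N -> unorm (u n i - l i) < e.
  move=> e0; have [N uN] := uC _ e0; exists N => n i Nn.
  have [N' uN'] := ul i _ e0; pose m := maxn N N'.
  have -> : u n i - l i = (u n i - u m i) + (u m i - l i).
    by rewrite addrA subrK.
  apply: le_lt_trans (unormD _ _) _; rewrite gt_max uN' ?leq_maxr// andbT.
  apply: le_lt_trans (uN n m Nn (leq_maxl _ _)).
  exact: (bprod_norm_ub (u n - u m) i).
have lb : has_ubound (range (fun i => unorm (l i))).
  have [N uN] := unif 1 ltr01; have [M uM] := bprod_bounded (u N).
  exists (Num.max M 1) => _ [i _ <-].
  have -> : l i = u N i - (u N i - l i) by rewrite subKr.
  apply: le_trans (unormB _ _) _; rewrite ge_max !le_max.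
  have -> : unorm (u N i) <= M by apply: uM; exists i.
  by rewrite (ltW (uN N i (leqnn N))) orbT.
exists (BProd lb) => e e0.
have e20 : 0 < e / 2 by rewrite divr_gt0.
have [N uN] := unif _ e20; exists N => n Nn.
apply: le_lt_trans (_ : e / 2 < e); last by rewrite ltr_pdivrMr// ltr_pMr// ltr1n.
by apply: bprod_norm_le => [|i]; [exact: ltW|exact/ltW/uN].
Qed.

HB.instance Definition _ :=
  UltraNormedZmodule_isBanach.Build R bprod bprod_complete.

End BoundedProduct.

Section CompletedSum.
Context (R : realType) (J : Type) (W : J -> ultraBanachType R).

Definition vanishing (y : bprod W) :=
  forall e : R, 0 < e -> finite_set [set j | e < unorm (y j)].

Record csum := CSum {
  csum_val :> bprod W;
  csum_vanishing : vanishing csum_val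
}.

Lemma csum_val_inj : injective csum_val.
Proof.
by move=> [x xv] [y yv] /= xy; subst y; congr CSum; exact: Prop_irrelevance.
Qed.

HB.instance Definition _ := gen_eqMixin csum.
HB.instance Definition _ := gen_choiceMixin csum.

Fact csum_zero_vanishing : vanishing 0.
Proof.
move=> e e0; apply: sub_finite_set (finite_set0 J) => j /=.
by rewrite unorm0 ltNge (ltW e0).
Qed.

Fact csum_opp_vanishing (x : csum) : vanishing (- csum_val x).
Proof.
move=> e e0; apply: sub_finite_set (csum_vanishing x e0) => j /=.
by rewrite unormN.
Qed.

Fact csum_add_vanishing (x y : csum) : vanishing (csum_val x + csum_val y).
Proof.
move=> e e0; apply: (@sub_finite_set _ _ ([set j | e < unorm (x j)] `|`
    [set j | e < unorm (y j)])); last first.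
  by rewrite finite_setU; split; exact: csum_vanishing.
move=> j /= /lt_le_trans /(_ (unormD _ _)).
by rewrite lt_max => /orP[]; [left|right].
Qed.

Definition csum_zero := CSum csum_zero_vanishing.
Definition csum_opp x := CSum (@csum_opp_vanishing x).
Definition csum_add x y := CSum (@csum_add_vanishing x y).

Fact csum_addA : associative csum_add.
Proof. by move=> x y z; apply: csum_val_inj; rewrite /= addrA. Qed.

Fact csum_addC : commutative csum_add.
Proof. by move=> x y; apply: csum_val_inj; rewrite /= addrC. Qed.

Fact csum_add0 : left_id csum_zero csum_add.
Proof. by move=> x; apply: csum_val_inj; rewrite /= add0r. Qed.

Fact csum_addN : left_inverse csum_zero csum_opp csum_add.
Proof. by move=> x; apply: csum_val_inj; rewrite /= addNr. Qed.

HB.instance Definition _ := GRing.isZmodule.Build csum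
  csum_addA csum_addC csum_add0 csum_addN.

Definition csum_norm (x : csum) : R := unorm (csum_val x).

Fact csum_norm_ge0 x : 0 <= csum_norm x.
Proof. exact: unorm_ge0. Qed.

Fact csum_normB x y : csum_norm (x - y) <= Num.max (csum_norm x) (csum_norm y).
Proof. exact: unormB. Qed.

Fact csum_norm_eq0 x : csum_norm x = 0 <-> x = 0.
Proof.
split=> [/unorm_eq0 x0|->]; first exact: csum_val_inj.
exact/unorm_eq0.
Qed.

HB.instance Definition _ := Zmodule_isUltraNormed.Build R csum
  csum_norm_ge0 csum_normB csum_norm_eq0.

Fact csum_complete (u : nat -> csum) : ucauchy u -> exists l, uconverges u l.
Proof.
move=> uC; have [l ul] : exists l, uconverges (fun n => csum_val (u n)) l.
  exact: ucomplete.
suff lv : vanishing l by exists (CSum lv).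
move=> e e0; have [N uN] := ul _ e0.
apply: sub_finite_set (csum_vanishing (u N) e0) => j /= elj.
rewrite ltNge; apply/negP => uNe.
move: elj; rewrite ltNge => /negP; apply.
have -> : l j = u N j - (csum_val (u N) - l) j by rewrite /= subKr.
apply: le_trans (unormB _ _) _; rewrite ge_max uNe/=.
exact: le_trans (bprod_norm_ub _ j) (ltW (uN N (leqnn N))).
Qed.

HB.instance Definition _ :=
  UltraNormedZmodule_isBanach.Build R csum csum_complete.

End CompletedSum.

Definition countably_complete (I : Type) (F : set_system I) :=
  forall A : nat -> set I, (forall n, F (A n)) -> F (\bigcap_n A n).

Definition beta_omega (I : Type) : set (set_system I) :=
  [set F | UltraFilter F /\ countably_complete F].

Definition bprod_sub (R : realType) (I : Type) (V : I -> ultraBanachType R)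
    (U0 : set (set_system I)) (r : R) : set (bprod V) :=
  [set x | (forall F, U0 F -> F [set i | x i = 0]) /\
           (forall i, unorm (x i) <= r)].

Definition csum_sub (R : realType) (J : Type) (W : J -> ultraBanachType R)
    (J0 : set J) (r : R) : set (csum W) :=
  [set y | forall j, ~ J0 j -> unorm (y j) <= r].

(* Main.v *)
Require Import Defs.
From mathcomp Require Import all_boot all_order all_algebra.
From mathcomp Require Import all_classical all_reals.

Set Implicit Arguments.
Unset Strict Implicit.
Unset Printing Implicit Defensive.

Import Order.TTheory GRing.Theory Num.Theory.

Local Open Scope classical_set_scope.
Local Open Scope ring_scope.

(** The proof is a gliding-hump argument.  Write [c] for the operator norm of
    [f] and call [S] negligible when, for some radius [rho > r / c] and some
    finite [K], every [x] supported in [S] with entries of norm at most [rho]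
    has [|f x j| <= r] for all [j] outside [K].

    Suppose vectors [x n] hit [j n] hard, [|f (x n) (j n)| > r], at successive
    coordinates.  The coordinate [j n] can be chosen outside the finite set
    where one of the earlier [f (x m)] exceeds [r], and, since radii may be
    taken as close to [r / c] as one likes, all later [x m] can be taken so
    short that [f] cannot bring them up to [|f (x n) (j n)|].  By the
    ultrametric inequality the [n]-th hump then dominates at [j n] whatever is
    added to it.  If every index lies in the support of only finitely many
    [x n], the [x n] have a pointwise sum [y], although they do not tend to
    [0]; it satisfies [|f y (j n)| > r] for infinitely many [j n], which is
    impossible in a completed direct sum ([no_faded_humps]).

    Consequently the negligible sets form an ideal meeting every decreasing
    sequence with empty intersection ([negligible_ideal]).  Such an ideal is
    closed under countable unions, and one cannot remove non-negligible pieces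
    from [I] infinitely often; so [I] splits, modulo the ideal, into finitely
    many atoms, each of which carries a countably complete ultrafilter
    ([continuous_ideal_controlled]).  A vector whose zero set belongs to all of
    these ultrafilters has negligible support.

    The radius and the finite set still depend on the support.  They can be
    chosen once and for all ([negligible_uniform]): otherwise there would be
    humps with negligible supports, and the union of these supports would be
    negligible, so that almost all [j n], which are distinct, would lie in one
    finite set. *)

(** * Finitely many ultrafilters controlling an ideal *)

Definition fades (I : Type) (S : nat -> set I) :=
  (forall m n, (m <= n)%N -> S n `<=` S m) /\ (forall i, exists n, ~ S n i).

Section Ideal.
Context (I : Type) (N : set (set I)).

Record continuous_ideal : Prop := ContinuousIdeal {
  ideal0 : N set0;
  idealS : forall A B, A `<=` B -> N B -> N A;
  idealU : forall A B, N A -> N B -> N (A `|` B);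
  ideal_fades : forall S, fades S -> exists n, N (S n)
}.

Hypothesis NI : continuous_ideal.

(** With [B n] the union of the first [n] sets, what remains of the whole union
    after removing [B n] decreases to the empty set; so some remainder is in
    the ideal already, and [B n] makes up for the rest. *)
Lemma ideal_bigcup (A : nat -> set I) :
  (forall n, N (A n)) -> N (\bigcup_n A n).
Proof.
move=> NA; pose B n := \bigcup_(k in [set k | (k < n)%N]) A k.
have NB n : N (B n).
  elim: n => [|n IHn].
    by apply: (idealS NI) (ideal0 NI) => i [].
  apply: (idealS NI) (idealU NI IHn (NA n)) => i [k /=].
  rewrite ltnS leq_eqVlt => /orP[/eqP-> Ai|kn Ai]; first by right.
  by left; exists k.
have [n Nn] : exists n, N (\bigcup_n A n `\` B n).
  apply: (ideal_fades NI); split=> [m n mn i [Ai nBi]|i].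
    split=> // -[k /= km Aki]; apply: nBi; exists k => //=.
    exact: leq_trans km mn.
  have [[k _ Ai]|nAi] := pselect ((\bigcup_n A n) i).
    by exists k.+1 => -[_]; apply; exists k => /=.
  by exists 0%N => -[].
apply: (idealS NI) (idealU NI Nn (NB n)) => i Ai.
by have [Bi|nBi] := pselect (B n i); [right|left].
Qed.

(** Relative to a subset so that the property is additive: the finite set of
    ultrafilters for [setT] is assembled from pieces, without listing atoms. *)
Definition controlled (A : set I) := exists U : set (set_system I),
  [/\ finite_set U, U `<=` @beta_omega I &
      forall S, S `<=` A -> (forall F, U F -> F (~` S)) -> N S].

Lemma controlledU A B : controlled A -> controlled B -> controlled (A `|` B).
Proof.
move=> [U [Ufin Uom UN]] [U' [U'fin U'om U'N]]; exists (U `|` U'); split.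
- by rewrite finite_setU.
- by move=> F [/Uom|/U'om].
move=> S SAB US.
apply: (idealS NI) (idealU NI (UN (S `&` A) _ _) (U'N (S `&` B) _ _)).
- by move=> i Si; case: (SAB i Si); [left|right].
- by move=> i [].
- move=> F UF; have [[[_ FF] _] _] := Uom _ UF.
  by apply: filterS (US F (or_introl UF)) => i nSi [].
- by move=> i [].
- move=> F UF; have [[[_ FF] _] _] := U'om _ UF.
  by apply: filterS (US F (or_intror UF)) => i nSi [].
Qed.

(** [A] is an atom of the quotient of the power set by the ideal; the filter
    consists of the sets that contain [A] up to the ideal. *)
Lemma atom_ultrafilter A : ~ N A ->
  (forall S, N (A `&` S) \/ N (A `\` S)) ->
  beta_omega [set S | N (A `\` S)].
Proof.
move=> nNA atomA; split; last first.
  move=> S NS /=; apply: (idealS NI) (ideal_bigcup NS) => i [Ai] /=.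
  by apply: contra_notP => nS k _; apply: contrapT => nSi; apply: nS; exists k.
split=> [|G [nG0 GF] leG].
  split; first by rewrite /= setD0.
  split=> /=.
  - by rewrite setDT; exact: ideal0.
  - by move=> S T NS NT; rewrite /mkset setDIr; exact: idealU.
  - by move=> S T ST; apply: (idealS NI) => i [Ai nTi]; split=> // /ST.
rewrite eqEsubset; split=> // S GS /=; have [NAS|//] := atomA S.
have GnS : G (~` S) by apply: leG; rewrite /= setDE setCK.
by case: nG0; rewrite -(setICr S); exact: filterI.
Qed.

(** Members of the ideal are controlled by no ultrafilter at all and atoms by a
    single one; so [A] is neither, and it splits into two parts outside the
    ideal.  They cannot both be controlled. *)
Lemma not_controlled_split A : ~ controlled A ->
  exists B, [/\ B `<=` A, ~ controlled B & ~ N (A `\` B)].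
Proof.
move=> ncA; have nNA : ~ N A.
  move=> NA; apply: ncA; exists set0; split=> // S SA _; exact: idealS SA NA.
have [S [nN1 nN2]] : exists S, ~ N (A `&` S) /\ ~ N (A `\` S).
  apply: contrapT => noS; apply: ncA; exists [set [set S | N (A `\` S)]].
  split=> [|_ -> |S SA NS]; first exact: finite_set1.
    apply: atom_ultrafilter => // S.
    by apply: contrapT => /not_orP nN; apply: noS; exists S.
  by move: (NS _ erefl) => /=; rewrite setDE setCK setIidr.
have [c1|nc1] := pselect (controlled (A `&` S)); last first.
  exists (A `&` S); split=> //.
  by rewrite setDIr setDv set0U.
exists (A `\` S); split; first by move=> i [].
- move=> c2; apply: ncA; suff <- : (A `&` S) `|` (A `\` S) = A.
    exact: controlledU.
  by rewrite setUIDK.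
- by rewrite setDD.
Qed.

(** Otherwise iterated splitting yields a decreasing sequence whose successive
    differences are outside the ideal; removing its intersection gives a
    sequence that decreases to the empty set, of which no member can be in the
    ideal, since it contains one of these differences. *)
Lemma continuous_ideal_controlled : controlled setT.
Proof.
apply: contrapT => ncT.
have /choice[g gP] : forall A, exists B, ~ controlled A ->
    [/\ B `<=` A, ~ controlled B & ~ N (A `\` B)].
  move=> A; have [cA|/not_controlled_split[B BP]] := pselect (controlled A).
    by exists A.
  by exists B.
pose A n := iter n g setT.
have ncA n : ~ controlled (A n) by elim: n => // n /gP[].
have subA m n : (m <= n)%N -> A n `<=` A m.
  elim: n => [|n IHn]; first by rewrite leqn0 => /eqP->.
  rewrite leq_eqVlt => /orP[/eqP->//|/IHn An]; apply: subset_trans An.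
  by case: (gP _ (ncA n)).
have [n Nn] : exists n, N (A n `\` \bigcap_k A k).
  apply: (ideal_fades NI); split=> [m n mn i [/(subA _ _ mn)]|i] //.
  have [Ai|] := pselect ((\bigcap_k A k) i); first by exists 0%N => -[].
  by move=> /existsNP[k /not_implyP[_ nAi]]; exists k => -[].
case: (gP _ (ncA n)) => _ _; apply; apply: (idealS NI) Nn => i [Ai nAi].
by split=> // /(_ n.+1 Logic.I).
Qed.

End Ideal.

(** * Gliding humps *)

Section UltrametricSums.
Context (R : realType) (I : Type) (V : I -> ultraBanachType R).

Lemma unorm_dominant (A : ultraNormedZmodType R) (a b : A) (r : R) :
  r < unorm b -> unorm a < unorm b -> r < unorm (a + b).
Proof.
move=> rb ab; have := unormB (a + b) a.
rewrite addrAC subrr add0r le_max => /orP[|/(lt_le_trans ab)].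
  exact: lt_le_trans.
by rewrite ltxx.
Qed.

(** A series that need not converge in norm: it is summed at each index
    separately, where only finitely many terms survive, and the ultrametric
    inequality still bounds each remainder by a bound on its terms. *)
Lemma pointwise_sum (u : nat -> bprod V) (b : nat -> R) :
  (forall i, exists N, forall m, (N <= m)%N -> u m i = 0) ->
  (forall n, 0 <= b n) ->
  (forall n m i, (n <= m)%N -> unorm (u m i) <= b n) ->
  exists x : bprod V,
    forall n i, unorm ((x - \sum_(m < n) u m) i) <= b n.
Proof.
move=> /choice[N uN] b0 ub; pose s n := \sum_(m < n) u m.
have sS n i : s n.+1 i = s n i + u n i by rewrite /s big_ord_recr.
have stab i n : (N i <= n)%N -> s n i = s (N i) i.
  elim: n => [|n IHn]; first by rewrite leqn0 => /eqP->.
  rewrite leq_eqVlt => /orP[/eqP->//|Nn].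
  by rewrite sS uN// addr0 IHn.
have diff n i k : unorm (s (n + k)%N i - s n i) <= b n.
  elim: k => [|k IHk]; first by rewrite addn0 subrr unorm0.
  rewrite addnS sS addrAC (le_trans (unormD _ _))// ge_max IHk/=.
  by rewrite ub ?leq_addr.
have lim n i : unorm (s (N i) i - s n i) <= b n.
  by rewrite -(stab i (n + N i)%N) ?leq_addl.
have bounded : has_ubound (range (fun i => unorm (s (N i) i))).
  exists (b 0%N) => _ [i _ <-]; have := lim 0%N i.
  by rewrite {2}/s big_ord0 /= subr0.
by exists (BProd bounded) => n i; exact: lim.
Qed.

Definition restrict_fun (S : set I) (x : bprod V) i : V i :=
  if pselect (S i) then x i else 0.

Lemma restrict_bounded S x :
  has_ubound (range (fun i => unorm (restrict_fun S x i))).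
Proof.
exists (bprod_norm x) => _ [i _ <-]; rewrite /restrict_fun.
by case: pselect => Si; [exact: bprod_norm_ub|rewrite unorm0 bprod_norm_ge0].
Qed.

Definition restrict S x := BProd (restrict_bounded S x).

End UltrametricSums.

Lemma inj_seq_leaves_finite (J : Type) (j : nat -> J) (K : set J) (N : nat) :
  (forall m n, (m < n)%N -> j m <> j n) -> finite_set K ->
  exists2 n, (N <= n)%N & ~ K (j n).
Proof.
move=> jI finK; apply: contrapT => noN.
apply: infinite_nat; suff -> : [set: nat] = (fun n => j (N + n)%N) @^-1` K.
  apply: finite_preimage finK => m n _ _ jE.
  have [mn|nm|//] := ltngtP m n.
    by case: (jI (N + m)%N (N + n)%N _ jE); rewrite ltn_add2l.
  by case: (jI (N + n)%N (N + m)%N _ (esym jE)); rewrite ltn_add2l.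
rewrite predeqE => n; split=> // _ /=; apply: contrapT => nK.
by apply: noN; exists (N + n)%N; rewrite ?leq_addr.
Qed.

Section GlidingHump.
Context (R : realType) (I J : Type).
Context (V : I -> ultraBanachType R) (W : J -> ultraBanachType R).
Context (f : {additive bprod V -> csum W}) (c r : R).
Hypotheses (c_gt0 : 0 < c) (fc : forall x, unorm (f x) <= c * unorm x).
Hypothesis (r_gt0 : 0 < r).

Lemma image_le (x : bprod V) (M : R) j :
  0 <= M -> (forall i, unorm (x i) <= M) -> unorm (f x j) <= c * M.
Proof.
move=> M0 xM; apply: le_trans (bprod_norm_ub _ j) _.
apply: le_trans (fc x) _; rewrite ler_pM2l//; exact: bprod_norm_le.
Qed.

Lemma imageD (x y : bprod V) j : f (x + y) j = f x j + f y j.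
Proof. by rewrite raddfD. Qed.

Lemma threshold_gt0 rho : r < c * rho -> 0 < rho.
Proof. by move=> /(lt_trans r_gt0); rewrite pmulr_rgt0. Qed.

(** The [n]-th hump stands out at [j n]: the earlier ones have images of norm
    at most [r] there, and the later ones have norm at most [rho n.+1], which
    is too small for their images to reach its height. *)
Definition humps (x : nat -> bprod V) (j : nat -> J) (rho : nat -> R) :=
  [/\ forall n m i, (n <= m)%N -> unorm (x m i) <= rho n,
      forall n, r < c * rho n,
      forall n, c * rho n.+1 < unorm (f (x n) (j n)) &
      forall m n, (m < n)%N -> unorm (f (x m) (j n)) <= r].

Lemma humps_distinct x j rho m n : humps x j rho -> (m < n)%N -> j m <> j n.
Proof.
move=> [_ rrho fx fx_le] mn jE; have := fx_le _ _ mn.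
by rewrite -jE leNgt (lt_trans (rrho _) (fx m)).
Qed.

(** The sets [E n] leave room for constraints on the supports and, besides the
    radius already reached, on the sizes of the humps. *)
Lemma hump_sequence (E : nat -> set (bprod V)) :
  (forall n rho K, r < c * rho -> finite_set K ->
     exists x j, [/\ E n x, forall i, unorm (x i) <= rho, ~ K j &
                     r < unorm (f x j)]) ->
  exists (x : nat -> bprod V) (j : nat -> J) (rho : nat -> R),
    (forall n, E n (x n)) /\ humps x j rho.
Proof.
move=> step.
have r0 : r < c * ((r + 1) / c) by rewrite mulrCA divff ?gt_eqF// mulr1 ltrDl.
have [x0 [j0 _]] := step 0%N _ set0 r0 (finite_set0 _).
have /choice[g gP] : forall s : nat * (R * set J), exists p : bprod V * J,
    r < c * s.2.1 -> finite_set s.2.2 ->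
    [/\ E s.1 p.1, forall i, unorm (p.1 i) <= s.2.1, ~ s.2.2 p.2 &
        r < unorm (f p.1 p.2)].
  case=> n [rho K] /=.
  have [[h1 h2]|h] := pselect (r < c * rho /\ finite_set K).
    by have [x [j xj]] := step n rho K h1 h2; exists (x, j).
  by exists (x0, j0) => h1 h2; case: h.
(* The next radius is chosen so that [c] times it is midway between [r] and the
   height of the current hump: admissible, yet too short to hide that hump. *)
pose next n (s : R * set J) := let p := g (n, s) in
  ((r + unorm (f p.1 p.2)) / 2 / c, s.2 `|` [set j | r < unorm (f p.1 j)]).
pose st := fix st n := if n is n'.+1 then next n' (st n')
  else ((r + 1) / c, set0).
pose x n := (g (n, st n)).1; pose j n := (g (n, st n)).2.
pose rho n := (st n).1; pose K n := (st n).2.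
have rhoS n : c * rho n.+1 = (r + unorm (f (x n) (j n))) / 2.
  by rewrite /rho /= mulrCA divff ?gt_eqF// mulr1.
have KS n : K n.+1 = K n `|` [set j | r < unorm (f (x n) j)] by [].
have inv n : r < c * rho n /\ finite_set (K n).
  elim: n => [|n [IHr IHK]]; first by split; [exact: r0|exact: finite_set0].
  have [_ _ _ h] := gP (n, st n) IHr IHK.
  split; first by rewrite rhoS (midf_lt h).
  rewrite KS finite_setU; split=> //; exact: csum_vanishing.
have xP n : [/\ E n (x n), forall i, unorm (x n i) <= rho n, ~ K n (j n) &
    r < unorm (f (x n) (j n))].
  by have [h1 h2] := inv n; exact: (gP (n, st n)).
have rho_decr n : rho n.+1 <= rho n.
  have [_ xr _ h] := xP n; have [h0 _] := inv n.
  rewrite -(ler_pM2l c_gt0) rhoS.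
  apply: le_trans (image_le (j n) _ xr); last exact/ltW/threshold_gt0.
  by rewrite (midf_le (ltW h)).
have rho_mono n m : (n <= m)%N -> rho m <= rho n.
  elim: m => [|m IHm]; first by rewrite leqn0 => /eqP->.
  rewrite leq_eqVlt => /orP[/eqP->//|/IHm]; exact: le_trans.
have K_mono n m : (n <= m)%N -> K n `<=` K m.
  elim: m => [|m IHm]; first by rewrite leqn0 => /eqP->.
  rewrite leq_eqVlt => /orP[/eqP->//|/IHm h]; rewrite KS => k /h; by left.
exists x, j, rho; split; first by move=> n; case: (xP n).
split.
- move=> n m i nm; case: (xP m) => _ /(_ i) /le_trans + _ _; apply.
  exact: rho_mono.
- by move=> n; case: (inv n).
- by move=> n; rewrite rhoS; case: (xP n) => _ _ _ /midf_lt[].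
- move=> m n mn; rewrite leNgt; apply/negP => h; case: (xP n) => _ _ + _; apply.
  by apply: (K_mono m.+1 n mn); rewrite KS; right.
Qed.


(** Here [y] is the sum of all the [x n].  At [j n], its image is the sum of
    three terms: the image of the partial sum, at most [r], that of the
    remainder, and that of [x n], which strictly dominates the other two. *)
Lemma no_faded_humps (x : nat -> bprod V) j rho :
  (forall i, exists N, forall m, (N <= m)%N -> x m i = 0) -> ~ humps x j rho.
Proof.
move=> x0 xH; have [xrho rrho fx fx_le] := xH.
have rho_ge0 n : 0 <= rho n by exact/ltW/threshold_gt0/rrho.
have [y yP] := pointwise_sum x0 rho_ge0 xrho.
have [n _] := inj_seq_leaves_finite 0%N (fun m n => humps_distinct xH)
  (csum_vanishing (f y) r_gt0).
apply => /=.
have -> : y = (\sum_(m < n) x m + (y - \sum_(m < n.+1) x m)) + x n.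
  by rewrite [\sum_(m < n.+1) _]big_ord_recr/= addrAC subrKC.
rewrite imageD; apply: unorm_dominant; first exact: lt_trans (rrho _) (fx n).
rewrite imageD; apply: le_lt_trans (unormD _ _) _; rewrite gt_max.
apply/andP; split.
  apply: le_lt_trans (lt_trans (rrho _) (fx n)).
  suff: forall k, (k <= n)%N ->
    unorm (f (\sum_(m < k) x m) (j n)) <= r by exact.
  elim=> [_|k IHk kn]; first by rewrite big_ord0 raddf0 unorm0 ltW.
  rewrite big_ord_recr imageD (le_trans (unormD _ _))// ge_max fx_le// andbT.
  exact/IHk/ltnW.
apply: le_lt_trans (fx n); apply: image_le => // i; exact: yP.
Qed.

(** The bounds [rho] and [K] may depend on [S]; this is what makes additivity
    immediate, and what [negligible_uniform] later repairs. *)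
Definition negligible : set (set I) := [set S | exists rho K,
  [/\ r < c * rho, finite_set K & forall x : bprod V,
      (forall i, ~ S i -> x i = 0) -> (forall i, unorm (x i) <= rho) ->
      forall j, ~ K j -> unorm (f x j) <= r]].

Lemma not_negligibleP S rho K : ~ negligible S ->
  r < c * rho -> finite_set K ->
  exists (x : bprod V) (j : J), [/\ forall i, ~ S i -> x i = 0,
    forall i, unorm (x i) <= rho, ~ K j & r < unorm (f x j)].
Proof.
move=> nS h1 h2; apply: contrapT => noxj; apply: nS; exists rho, K; split=> //.
move=> x xS xrho j nKj; rewrite leNgt; apply/negP => h; apply: noxj.
by exists x, j.
Qed.

(** Additivity comes from the ultrametric inequality, applied to the two
    restrictions of a vector.  If no member of a fading sequence [S] were
    negligible, there would be humps supported in the successive [S n], and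
    only finitely many of them would live at any given index. *)
Lemma negligible_ideal : continuous_ideal negligible.
Proof.
split.
- exists ((r + 1) / c), set0; split; last 1 first.
  + move=> x x0 _ j _; have -> : x = 0 by apply: bprod_eq => i; exact: x0.
    by rewrite raddf0 unorm0 ltW.
  + by rewrite mulrCA divff ?gt_eqF// mulr1 ltrDl.
  + exact: finite_set0.
- move=> A B AB [rho [K [h1 h2 BK]]]; exists rho, K; split=> // x xA.
  by apply: BK => i nBi; apply: xA => /AB.
- move=> A B [rho [K [h1 h2 AK]]] [rho' [K' [h1' h2' BK]]].
  exists (Num.min rho rho'), (K `|` K'); split.
  + by case: (leP rho rho').
  + by rewrite finite_setU.
  + move=> x xAB xrho j /not_orP[nKj nK'j].
    have -> : x = restrict A x + restrict (~` A) x.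
      apply: bprod_eq => i /=; rewrite /restrict_fun /=.
      by case: pselect => h; case: pselect => h' //; rewrite ?addr0 ?add0r.
    have xle i : (unorm (x i) <= rho) && (unorm (x i) <= rho').
      by rewrite -le_min.
    rewrite imageD (le_trans (unormD _ _))// ge_max; apply/andP; split.
      apply: AK => // i; rewrite /= /restrict_fun; case: pselect => // Ai.
        by case/andP: (xle i).
      by rewrite unorm0 ltW// (threshold_gt0 h1).
    apply: BK => // i; rewrite /= /restrict_fun; case: pselect => // nAi.
    - by move=> nBi; apply: xAB => -[].
    - by case/andP: (xle i).
    - by rewrite unorm0 ltW// (threshold_gt0 h1').
- move=> S [Sdecr Sfade]; apply: contrapT => /forallNP nS.
  have [x [j [rho [xS xH]]]] :=
    hump_sequence (fun n rho K => @not_negligibleP (S n) rho K (nS n)).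
  apply: no_faded_humps xH => i.
  have [N SN] := Sfade i; exists N => m Nm; apply: xS => Smi.
  exact/SN/(Sdecr _ _ Nm).
Qed.

(** The additional bound [r / c + n.+1%:R^-1] on the [n]-th hump forces the
    humps below the radius that belongs to the union of all the supports. *)
Lemma negligible_uniform : exists rho K,
  [/\ r < c * rho, finite_set K & forall x : bprod V,
      negligible [set i | x i <> 0] -> (forall i, unorm (x i) <= rho) ->
      forall j, ~ K j -> unorm (f x j) <= r].
Proof.
apply: contrapT => nouni.
pose E n := [set x : bprod V | negligible [set i | x i <> 0] /\
                               forall i, unorm (x i) <= r / c + n.+1%:R^-1].
have step n rho K : r < c * rho -> finite_set K ->
    exists x j, [/\ E n x, forall i, unorm (x i) <= rho, ~ K j &
                    r < unorm (f x j)].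
  move=> h1 h2; apply: contrapT => noxj; apply: nouni.
  exists (Num.min rho (r / c + n.+1%:R^-1)), K; split=> //.
    case: (leP rho) => // _; rewrite mulrDr mulrCA divff ?gt_eqF// mulr1.
    by rewrite ltrDl mulr_gt0// invr_gt0 ltr0n.
  move=> x xneg xmin j nKj; rewrite leNgt; apply/negP => h; apply: noxj.
  have xle i : (unorm (x i) <= rho) && (unorm (x i) <= r / c + n.+1%:R^-1).
    by rewrite -le_min.
  exists x, j; split=> // [|i]; last by case/andP: (xle i).
  by split=> // i; case/andP: (xle i).
have [x [j [rho [xE xH]]]] := hump_sequence step.
have [s [K [rs finK sK]]] :=
  ideal_bigcup negligible_ideal (fun n => proj1 (xE n)).
have [N Ns] : exists N, r / c + N.+1%:R^-1 < s.
  by apply: ltr_add_invr; rewrite ltr_pdivrMr// mulrC.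
have [n Nn nKj] := inj_seq_leaves_finite N (fun m n => humps_distinct xH) finK.
suff : unorm (f (x n) (j n)) <= r.
  by case: xH => _ rrho fx _; rewrite leNgt (lt_trans (rrho _) (fx n)).
apply: sK nKj => i.
  by apply: contra_notP => nxi; exists n.
apply: le_trans (proj2 (xE n) i) _; apply: le_trans (ltW Ns).
by rewrite lerD2l lef_pV2 ?posrE ?ltr0n// ler_nat.
Qed.

End GlidingHump.

(** * The operator norm *)

Lemma opnorm_bound (R : realType) (A B : ultraBanachType R)
    (f : {additive A -> B}) :
  bounded_hom f -> forall x, unorm (f x) <= opnorm f * unorm x.
Proof.
move=> fb x; have [x0|x0] := eqVneq (unorm x) 0.
  by move/unorm_eq0: x0 => ->; rewrite raddf0 !unorm0 mulr0.
have xp : 0 < unorm x by rewrite lt_neqAle eq_sym x0 unorm_ge0.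
rewrite -ler_pdivrMr//; apply: lb_le_inf => // C [_ /(_ x)].
by rewrite ler_pdivrMr.
Qed.

Lemma opnorm_gt0 (R : realType) (A B : ultraBanachType R)
    (f : {additive A -> B}) :
  bounded_hom f -> (exists x, f x <> 0) -> 0 < opnorm f.
Proof.
move=> fb [x fx0]; rewrite ltNge; apply/negP => f0; apply: fx0.
apply/unorm_eq0/eqP; rewrite eq_le unorm_ge0 andbT.
by rewrite (le_trans (opnorm_bound fb x))// mulr_le0_ge0 ?unorm_ge0.
Qed.

(** * The theorem *)

Theorem theorem4p1 (R : realType) (I J : Type)
    (V : I -> ultraBanachType R) (W : J -> ultraBanachType R)
    (f : {additive bprod V -> csum W})
    (f_bounded : bounded_hom f) (f_neq0 : exists x, f x <> 0) :
  forall r : R, 0 < r ->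
  exists (r' : R) (U0 : set (set_system I)) (J0 : set J),
    [/\ (opnorm f)^-1 * r < r',
        finite_set U0 /\ U0 `<=` @beta_omega I,
        finite_set J0 &
        f @` bprod_sub U0 r' `<=` csum_sub J0 r].
Proof.
move=> r r0; have f0 := opnorm_gt0 f_bounded f_neq0.
have fb := opnorm_bound f_bounded.
have [U0 [U0fin U0om U0N]] :=
  continuous_ideal_controlled (negligible_ideal f0 fb r0).
have [r' [J0 [rr' J0fin J0P]]] := negligible_uniform f0 fb r0.
exists r', U0, J0; split=> //; first by rewrite mulrC ltr_pdivrMr// mulrC.
move=> _ [x [xU xr'] <-] j; apply: J0P => //.
apply: U0N => // F /xU; congr F; rewrite predeqE => i /=.
by split=> [->|/contrapT//]; apply.
Qed.
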